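(* Let $n\ge m\ge 1$ be integers. Then $$ex(n,m;\mathbb{T}_{n,m})=(n-1)m.$$ Furthermore, the extremal graphs for $\mathbb{T}_{n,m}$ are characterized as follows. (1) If $n=m$, then the extremal graphs for $\mathbb{T}_{n,n}$ are exactly the $(n,n)$-bipartite graphs $G[U,V;E]$ such that every vertex in $U$ has degree $n-1$, or every vertex in $V$ has degree $n-1$. (2) If $n=m+1$, then the extremal graphs for $\mathbb{T}_{n,m}$ are exactly the $(n,m)$-bipartite graphs $G[U,V;E]$ (with $|U|=n$, $|V|=m$) such that either every vertex in $V$ has degree $n-1$, or the vertices of $V$ can be labelled $v_1,\dots,v_m$ with $d(v_1)=1$ and $d(v_2)=\dots=d(v_m)=n$. (3) If $n>m+1$, then the extremal graphs for $\mathbb{T}_{n,m}$ are exactly the $(n,m)$-bipartite graphs $G[U,V;E]$ (with $|U|=n$, $|V|=m$) such that every vertex in $V$ has degree $n-1$.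
   Context: All graphs are finite, simple and undirected. An $(n,m)$-bipartite graph $G[U,V;E]$ (with $n,m$ positive integers) is a bipartite graph whose vertex set is the disjoint union of $U$ and $V$ with $|U|=n$, $|V|=m$, every edge joining a vertex of $U$ to a vertex of $V$. $d(v)$ denotes the degree of $v$. $\mathbb{T}_{k,l}$ is the set of all trees that are $(k,l)$-bipartite graphs, i.e. trees of order $k+l$ whose two colour classes have sizes $k$ and $l$. A graph $G$ contains a tree $T$ as a subgraph if there is an injection $f:V(T)\to V(G)$ with $f(x)f(y)\in E(G)$ whenever $xy\in E(T)$ (no requirement is made on which colour class of $T$ goes to which side of $G$). $ex(n,m;\mathbb{T}_{k,l})$ is the maximum number of edges of an $(n,m)$-bipartite graph that does not contain all trees of $\mathbb{T}_{k,l}$ as subgraphs, i.e. that fails to contain at least one tree of $\mathbb{T}_{k,l}$. An extremal graph for $\mathbb{T}_{k,l}$ is an $(n,m)$-bipartite graph with exactly $ex(n,m;\mathbb{T}_{k,l})$ edges that does not contain all trees of $\mathbb{T}_{k,l}$. *)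

(* Defs.v *)
From mathcomp Require Import all_boot.
From mathcomp Require Import boolp.

Set Implicit Arguments.
Unset Strict Implicit.
Unset Printing Implicit Defensive.

(* The classes are U = 'I_n and V = 'I_m, the vertex set is their disjoint
   union 'I_n + 'I_m, and a graph is the set of its edges uv, each written
   once as (u, v). *)
Definition bipgraph (n m : nat) : Type := {set 'I_n * 'I_m}.

Definition edges n m (G : bipgraph n m) : {set 'I_n * 'I_m} := G.

Definition adj n m (G : bipgraph n m) : rel ('I_n + 'I_m) :=
  fun x y => match x, y with
  | inl u, inr v => (u, v) \in edges G
  | inr v, inl u => (u, v) \in edges G
  | _, _ => false
  end.

Definition degree n m (G : bipgraph n m) (x : 'I_n + 'I_m) : nat :=
  #|[set y | adj G x y]|.

(* For a symmetric relation, an edge xy makes [:: x; y] a ucycle, hence the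
   bound on the size. *)
Definition acyclic (T : finType) (e : rel T) : Prop :=
  forall s : seq T, 2 < size s -> ~ ucycle e s.

Definition connected (T : finType) (e : rel T) : Prop :=
  0 < #|T| /\ forall x y : T, connect e x y.

Definition is_tree k l (T : bipgraph k l) : Prop :=
  connected (adj T) /\ acyclic (adj T).

Definition contains n m k l (G : bipgraph n m) (T : bipgraph k l) : Prop :=
  exists f : 'I_k + 'I_l -> 'I_n + 'I_m,
    injective f /\ forall x y, adj T x y -> adj G (f x) (f y).

Definition contains_all_trees k l n m (G : bipgraph n m) : Prop :=
  forall T : bipgraph k l, is_tree T -> contains G T.

(* For k, l >= 1 the graph without edges contains no tree of the family, so
   the maximum is not over an empty set. *)
Definition ex (n m k l : nat) : nat :=
  \max_(G : {set 'I_n * 'I_m} | `[< ~ contains_all_trees k l (G : bipgraph n m) >])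
    #|edges G|.

Definition extremal k l n m (G : bipgraph n m) : Prop :=
  #|edges G| = ex n m k l /\ ~ contains_all_trees k l G.

(* Main.v *)
(** Let H be the bipartite complement of G: then G contains a tree T of the
    family as soon as T and H can be packed edge-disjointly on U and V, and the
    claim is that this is possible when H has fewer than m edges, or exactly m
    edges and none of the listed degree patterns.  Only the acyclicity of T is
    used for this.

    If H has fewer than m edges, some u is isolated in H and may receive any
    vertex.  When the classes have equal sizes, take a leaf b of T in the class
    of V, send its neighbour to an isolated u and b to the end of an edge of H;
    when n > m, send any vertex to an isolated u.  Both steps preserve the
    hypothesis.

    If H has m edges, some u of degree 0 and some v of degree at least 2, sending
    a vertex b to v uses up two edges of H, after which the first case applies.
    The neighbours of b go to isolated vertices; a vertex b of minimum degree
    has few enough neighbours, unless n = m + 1 and all such b have degree 2.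
    Then b is chosen next to a leaf of T, and this leaf only has to avoid the
    neighbours of v in H, which is possible unless H is a star centred at v.

    Conversely, a double star with two dominating vertices excludes the regular
    patterns, and, when n = m + 1, a spider with legs of length 2 excludes a
    vertex of degree 1 in V. *)

Require Import Defs.
From mathcomp Require Import all_boot.
From mathcomp Require Import boolp.
From mathcomp Require Import zify.

Set Implicit Arguments.
Unset Strict Implicit.
Unset Printing Implicit Defensive.

(** * Trees from parent functions, and edge counts in forests *)

(** Passing to parents lowers [ht] until [r] is reached, which gives connectedness. On a cycle, the
    two neighbours of a vertex of maximal height would both be its parent. *)
Lemma rooted_tree (T : finType) (e : rel T) (r : T) (par : T -> T)
    (ht : T -> nat) :
  symmetric e ->
  (forall x, x != r -> e x (par x) /\ ht (par x) < ht x) ->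
  (forall x y, e x y -> ht y <= ht x -> y = par x) ->
  connected e /\ acyclic e.
Proof.
move=> esym parP parU; split.
  have to_r x : connect e x r.
    have [k] := ubnP (ht x); elim: k x => // k IHk x le_xk.
    have [-> // | x'r] := eqVneq x r.
    have [exp ltp] := parP x x'r.
    by apply: connect_trans (connect1 exp) (IHk _ _); lia.
  split; first by apply/card_gt0P; exists r.
  by move=> x y; apply: connect_trans (to_r x) _; rewrite (sym_connect_sym esym).
move=> s s_gt2 cyc_s.
have [x0 x0s] : exists x, x \in s by case: s s_gt2 {cyc_s} => // x s; exists x; rewrite mem_head.
have [x xs x_max] := @arg_maxnP _ x0 (mem s) ht x0s.
have [i s' def_s] := rot_to xs.
have: ucycle e (rot i s) by rewrite rot_ucycle.
have s'P y : y \in s' -> ht y <= ht x.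
  by move=> ys'; apply: x_max; rewrite inE -(mem_rot i) def_s inE ys' orbT.
move: s_gt2; rewrite -(size_rot i) def_s; case: s' s'P {def_s} => [|y [|z s']] //= s'P _.
case/andP=> /= /and3P[exy _]; rewrite rcons_path => /andP[_ ezx] /and4P[_ y_notin _ _].
have lzs : last z s' \in z :: s' by apply: mem_last.
have eqy := parU _ _ exy (s'P _ (mem_head _ _)).
have eqz : last z s' = par x.
  by apply: parU; [rewrite esym | apply: s'P; rewrite inE lzs orbT].
by rewrite eqy -eqz lzs in y_notin.
Qed.

(** If every vertex of W had two neighbours in W, a path in W could be prolonged at its first vertex
    forever: a further neighbour on the path would close a cycle. A path with more than [#|T|]
    vertices is absurd. *)
Lemma acyclic_leaf (T : finType) (e : rel T) (W : {set T}) :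
  symmetric e -> irreflexive e -> acyclic e -> W != set0 ->
  exists2 w, w \in W & #|[set y in W | e w y]| <= 1.
Proof.
move=> esym eirr acyc W_neq0.
apply/exists_inP; apply: contraT; rewrite negb_exists_in => /forall_inP no_leaf.
have long k : exists x p, [/\ size p = k, path e x p, uniq (x :: p)
                            & {subset x :: p <= W}].
  elim: k => [|k [x [p [sz_p e_p u_p sub_p]]]].
    have [x xW] := set0Pn _ W_neq0; exists x, [::]; split=> // y.
    by rewrite inE => /eqP->.
  have xW : x \in W by apply: sub_p; rewrite mem_head.
  (* [head x p] is the vertex after x on the path, or x itself if the path is trivial; of two
     neighbours one differs from it. *)
  have [y] : exists y, y \in [set y in W | e x y] :\ head x p.
    apply/card_gt0P; have := no_leaf x xW.
    by rewrite (cardsD1 (head x p)); lia.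
  rewrite !inE => /and3P[y'p yW exy].
  have [yp | y_notin] := boolP (y \in x :: p); last first.
    exists y, (x :: p); split=> /=; [by rewrite sz_p | by rewrite esym exy | by rewrite y_notin |].
    by move=> z; rewrite inE => /predU1P[-> // |]; apply: sub_p.
  move: yp; rewrite inE => /predU1P[eq_yx | yp]; first by rewrite eq_yx eirr in exy.
  move: e_p u_p y'p {sub_p sz_p}; case/path.splitP: yp => p1 p2.
  rewrite cat_path -cat_cons cat_uniq => /andP[e_p1 _] /and3P[u_p1 _ _] y'p.
  (* As y is not the successor of x, [p1] is nonempty and the cycle has at least three vertices. *)
  have [] := acyc (x :: rcons p1 y).
    by case: p1 y'p {e_p1 u_p1} => [|z p1] //=; rewrite ?size_rcons ?eqxx.
  by rewrite /ucycle u_p1 /= rcons_path e_p1 last_rcons esym exy.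
have [x [p [sz_p _ /card_uniqP u_p _]]] := long #|T|.
by have := max_card (mem (x :: p)); rewrite u_p /= sz_p ltnn.
Qed.

Lemma adj_sym n m (G : bipgraph n m) : symmetric (adj G).
Proof. by case=> [u|v] [u'|v']. Qed.

Lemma adj_irr n m (G : bipgraph n m) : irreflexive (adj G).
Proof. by case. Qed.

(** Induction on W: deleting a vertex with at most one neighbour in W loses at most one edge. *)
Lemma acyclic_edges n m (T : bipgraph n m) (W : {set 'I_n + 'I_m}) :
  acyclic (adj T) ->
  #|[set p in T | (inl p.1 \in W) && (inr p.2 \in W)]| <= #|W|.-1.
Proof.
move=> acyc; have [k] := ubnP #|W|; elim: k W => // k IHk W le_Wk.
have [-> | W_neq0] := eqVneq W set0.
  by rewrite cards0 leqn0 cards_eq0; apply/eqP/setP=> p; rewrite !inE !andbF.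
have [w wW leaf_w] := acyclic_leaf (@adj_sym _ _ T) (@adj_irr _ _ T) acyc W_neq0.
set E := [set p in T | _]; set N := [set y in W | _] in leaf_w.
pose E' := [set p in T | (inl p.1 \in W :\ w) && (inr p.2 \in W :\ w)].
(* This settles W = {w}, where the truncated predecessor does not drop and no edge may be lost. *)
have sub_N : N \subset W :\ w.
  apply/subsetP=> y; rewrite !inE => /andP[-> ewy]; rewrite andbT.
  by apply: contraTneq ewy => ->; rewrite adj_irr.
have cardW : #|W| = #|W :\ w|.+1 by rewrite (cardsD1 w) wW.
have IHw : #|E'| <= #|W :\ w|.-1 by apply: IHk; lia.
(* [far] maps a lost edge to its end other than w, so the lost edges inject into the neighbours of
   w. *)
pose far (p : 'I_n * 'I_m) : 'I_n + 'I_m := if inl p.1 == w then inr p.2 else inl p.1.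
have hitsw p : p \in E :\: E' -> (inl p.1 == w) || (inr p.2 == w).
  rewrite !inE; case: (inl p.1 == w) => //; case: (inr p.2 == w) => //=.
  by rewrite andNb.
have inj_far : {in E :\: E' &, injective far}.
  move=> [u v] [u' v'] /hitsw /= h /hitsw /= h'; rewrite /far /=.
  case: (inl u =P w) h => [eu _ | _ /eqP ev];
    case: (inl u' =P w) h' => [eu' _ | _ /eqP ev'] /= efar; congruence.
have sub_far : far @: (E :\: E') \subset N.
  apply/subsetP=> _ /imsetP[[u v] uvE ->]; move: uvE; rewrite !inE /far /=.
  case: (eqVneq (inl u) w) => [<- |] /=.
    by move=> /and4P[_ ? _ ->].
  case: (eqVneq (inr v) w) => [<- |] /=.
    by move=> _ /and4P[_ ? -> _].
  by case: (_ \in T); rewrite ?andbT ?andNb.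
have leEN : #|E :\: E'| <= #|N|.
  by rewrite -(card_in_imset inj_far) subset_leq_card.
have leE : #|E| <= #|E'| + #|E :\: E'|.
  by rewrite -(cardsID E' E) leq_add2r subset_leq_card ?subsetIr.
have leN := subset_leq_card sub_N.
move: (#|E|) (#|E'|) (#|E :\: E'|) (#|N|) (#|W|) (#|W :\ w|) leE IHw leEN leaf_w cardW leN.
by clear; lia.
Qed.

(** * Edges between two vertex subsets and degree sums *)

Definition edges_in n m (G : bipgraph n m) (X : {set 'I_n}) (Y : {set 'I_m}) :=
  [set p in G | (p.1 \in X) && (p.2 \in Y)].

Lemma forest_edges n m (T : bipgraph n m) X Y :
  acyclic (adj T) -> #|edges_in T X Y| <= (#|X| + #|Y|).-1.
Proof.
move=> acyc.
pose W : {set 'I_n + 'I_m} := inl @: X :|: inr @: Y.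
have leW : #|W| <= #|X| + #|Y|.
  apply: leq_trans (leq_card_setU _ _) _.
  by apply: leq_add; apply: leq_imset_card.
have -> : edges_in T X Y = [set p in T | (inl p.1 \in W) && (inr p.2 \in W)].
  apply/setP=> -[u v]; rewrite !inE /= !mem_imset; try by [apply: inl_inj | apply: inr_inj].
  have -> : (inl u \in (inr @: Y : {set 'I_n + 'I_m})) = false by apply/imsetP=> -[].
  have -> : (inr v \in (inl @: X : {set 'I_n + 'I_m})) = false by apply/imsetP=> -[].
  by rewrite orbF.
by apply: leq_trans (acyclic_edges W acyc) _; rewrite -!subn1 leq_sub2r.
Qed.

Definition nbU n m (G : bipgraph n m) (X : {set 'I_n}) (y : 'I_m) :=
  [set x in X | (x, y) \in G].

Definition nbV n m (G : bipgraph n m) (Y : {set 'I_m}) (x : 'I_n) :=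
  [set y in Y | (x, y) \in G].

Lemma edges_in_sumU n m (G : bipgraph n m) X Y :
  #|edges_in G X Y| = \sum_(y in Y) #|nbU G X y|.
Proof.
rewrite -sum1_card (partition_big snd (fun y => y \in Y)) => [|p]; last by rewrite !inE => /and3P[].
apply: eq_bigr => y yY; rewrite sum1_card.
rewrite -[RHS](card_imset _ (_ : injective (fun x => (x, y)))) => [|x x' [] //].
apply: eq_card => -[u v]; rewrite unfold_in !inE /=.
apply/idP/imsetP => [/andP[/and3P[uvG uX vY] /eqP <-] | [x]].
  by exists u; rewrite // inE uX.
by rewrite inE => /andP[xX xyG] [-> ->]; rewrite xyG xX yY eqxx.
Qed.

Lemma edges_in_sumV n m (G : bipgraph n m) X Y :
  #|edges_in G X Y| = \sum_(x in X) #|nbV G Y x|.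
Proof.
rewrite -sum1_card (partition_big fst (fun x => x \in X)) => [|p]; last by rewrite !inE => /and3P[].
apply: eq_bigr => x xX; rewrite sum1_card.
rewrite -[RHS](card_imset _ (_ : injective (fun y => (x, y)))) => [|y y' [] //].
apply: eq_card => -[u v]; rewrite unfold_in !inE /=.
apply/idP/imsetP => [/andP[/and3P[uvG uX vY] /eqP <-] | [y]].
  by exists v; rewrite // inE vY.
by rewrite inE => /andP[yY xyG] [-> ->]; rewrite xyG xX yY eqxx.
Qed.

(** * Packings and their extension by one vertex *)

Lemma cardsD1_pred (T : finType) (A : {set T}) x :
  x \in A -> #|A :\ x| = #|A|.-1.
Proof. by move=> xA; rewrite (cardsD1 x A) xA. Qed.

(* The part of T on X and Y is packed with the part of H on P and Q. *)
Definition packs n m (T H : bipgraph n m) (X : {set 'I_n}) (Y : {set 'I_m})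
    (P : {set 'I_n}) (Q : {set 'I_m}) : Prop :=
  exists (f : 'I_n -> 'I_n) (g : 'I_m -> 'I_m),
    [/\ {in X &, injective f}, {in Y &, injective g},
        {in X, forall x, f x \in P}, {in Y, forall y, g y \in Q}
      & {in X & Y, forall x y, (x, y) \in T -> (f x, g y) \notin H}].

(** The images of the neighbours of a are not known in advance, so [safe] excludes a conflict for
    every possible image v in Q. *)
Lemma packs_placeU n m (T H : bipgraph n m) (X P : {set 'I_n}) (Y Q : {set 'I_m})
    (a u : 'I_n) :
  u \in P ->
  {in Y & Q, forall y v, (a, y) \in T -> (u, v) \notin H} ->
  packs T H (X :\ a) Y (P :\ u) Q -> packs T H X Y P Q.
Proof.
move=> uP safe [f [g [injf injg fP gQ fg]]].
have fP' x : x \in X -> x != a -> f x \in P :\ u by move=> xX x'a; rewrite fP // !inE x'a.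
exists (fun x => if x == a then u else f x), g; split=> //.
- move=> x x' xX x'X /=; case: (eqVneq x a) => [-> | xa]; case: (eqVneq x' a) => [-> | x'a] //.
  + by move=> eq_u; have := fP' x' x'X x'a; rewrite -eq_u !inE eqxx.
  + by move=> eq_u; have := fP' x xX xa; rewrite eq_u !inE eqxx.
  + by apply: injf; rewrite !inE ?xa ?x'a.
- by move=> x xX /=; case: (eqVneq x a) => // /(fP' x xX); rewrite inE => /andP[].
move=> x y xX yY /=; case: (eqVneq x a) => [-> | xa]; first by apply: safe; rewrite ?gQ.
by apply: fg; rewrite // !inE xa.
Qed.

Lemma packs_placeV n m (T H : bipgraph n m) (X P : {set 'I_n}) (Y Q : {set 'I_m})
    (b v : 'I_m) :
  v \in Q ->
  {in X & P, forall x u, (x, b) \in T -> (u, v) \notin H} ->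
  packs T H X (Y :\ b) P (Q :\ v) -> packs T H X Y P Q.
Proof.
move=> vQ safe [f [g [injf injg fP gQ fg]]].
have gQ' y : y \in Y -> y != b -> g y \in Q :\ v by move=> yY y'b; rewrite gQ // !inE y'b.
exists f, (fun y => if y == b then v else g y); split=> //.
- move=> y y' yY y'Y /=; case: (eqVneq y b) => [-> | yb]; case: (eqVneq y' b) => [-> | y'b] //.
  + by move=> eq_v; have := gQ' y' y'Y y'b; rewrite -eq_v !inE eqxx.
  + by move=> eq_v; have := gQ' y yY yb; rewrite eq_v !inE eqxx.
  + by apply: injg; rewrite !inE ?yb ?y'b.
- by move=> y yY /=; case: (eqVneq y b) => // /(gQ' y yY); rewrite inE => /andP[].
move=> x y xX yY /=; case: (eqVneq y b) => [-> | yb]; first by apply: safe; rewrite ?fP.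
by apply: fg; rewrite // !inE yb.
Qed.

(** * Packing with a sparse H *)

Lemma exists_isolated n m (H : bipgraph n m) (P : {set 'I_n}) Q :
  #|edges_in H P Q| < #|P| -> exists2 u, u \in P & nbV H Q u = set0.
Proof.
rewrite edges_in_sumV => lt_HP.
suff /exists_inP[u uP /eqP isou] : [exists u in P, nbV H Q u == set0] by exists u.
apply: contraLR lt_HP; rewrite negb_exists_in => /forall_inP nzH; rewrite -leqNgt -sum1_card.
by apply: leq_sum => u uP; rewrite card_gt0; apply: nzH.
Qed.

Lemma nbV0P n m (H : bipgraph n m) Q u v :
  nbV H Q u = set0 -> v \in Q -> (u, v) \notin H.
Proof. by move=> /setP/(_ v); rewrite !inE => /= + vQ; rewrite vQ => /= ->. Qed.

(** Otherwise there would be at least 2|Y| edges, more than the forest bound |X| + |Y| - 1. *)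
Lemma exists_degree_le1 n m (T : bipgraph n m) (X : {set 'I_n}) (Y : {set 'I_m}) :
  acyclic (adj T) -> 0 < #|Y| -> #|X| <= #|Y| ->
  exists2 y, y \in Y & #|nbU T X y| <= 1.
Proof.
move=> acyc Y_gt0 leXY; apply/exists_inP.
have := forest_edges X Y acyc; rewrite edges_in_sumU; apply: contraLR.
rewrite negb_exists_in -ltnNge => /forall_inP deg2.
apply: (@leq_trans (\sum_(y in Y) 2)); first by rewrite sum_nat_const; lia.
by apply: leq_sum => y yY; rewrite ltnNge deg2.
Qed.

Lemma edges_in_remove n m (H : bipgraph n m) P (Q : {set 'I_m}) v :
  v \in Q -> #|edges_in H P Q| = #|nbU H P v| + #|edges_in H P (Q :\ v)|.
Proof.
move=> vQ; rewrite !edges_in_sumU (big_setD1 v) //.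
Qed.

Lemma edges_in_sub n m (H : bipgraph n m) (P P' : {set 'I_n}) (Q Q' : {set 'I_m}) :
  P' \subset P -> Q' \subset Q -> #|edges_in H P' Q'| <= #|edges_in H P Q|.
Proof.
move=> sPP sQQ; apply/subset_leq_card/subsetP=> -[u v]; rewrite !inE /=.
by case/and3P=> -> uP vQ; rewrite (subsetP sPP) ?(subsetP sQQ).
Qed.

(** Induction on |X|. If |Y| < |X|, only X shrinks and the bound on H is unchanged. If |X| = |Y|,
    both shrink, so an edge of H must disappear as well. *)
Lemma packs_sparse n m (T H : bipgraph n m) (X P : {set 'I_n}) (Y Q : {set 'I_m}) :
  acyclic (adj T) -> #|X| = #|P| -> #|Y| = #|Q| -> #|Y| <= #|X| ->
  #|edges_in H P Q| <= #|Y|.-1 -> packs T H X Y P Q.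
Proof.
move=> acyc; have [k] := ubnP #|X|; elim: k X Y P Q => // k IHk X Y P Q le_Xk eqXP eqYQ leYX leH.
have [X0 | X_gt0] := posnP #|X|.
  exists id, id; move: leYX; rewrite X0 leqn0 cards_eq0 => /eqP ->.
  move/eqP: X0; rewrite cards_eq0 => /eqP ->.
  by split=> x; rewrite inE.
have [u uP isou] : exists2 u, u \in P & nbV H Q u = set0.
  by apply: exists_isolated; lia.
have subP : P :\ u \subset P by apply: subD1set.
have [ltYX | leXY] := ltnP #|Y| #|X|.
  have [a aX] : exists a, a \in X by apply/card_gt0P.
    apply: (packs_placeU (a := a) uP) => [y v _ vQ _|]; first exact: nbV0P vQ.
  apply: IHk; rewrite ?cardsD1_pred //; try lia.
  exact: leq_trans (edges_in_sub H subP (subxx Q)) leH.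
have [b bY degb] : exists2 y, y \in Y & #|nbU T X y| <= 1.
  by apply: (exists_degree_le1 acyc); lia.
(* The vertex a is the neighbour of b in X, or arbitrary if b has none. *)
have [a aX nba] : exists2 a, a \in X & nbU T X b \subset [set a].
  have [nb0 | [a]] := set_0Vmem (nbU T X b).
    by have [a aX] := card_gt0P X_gt0; exists a; rewrite // nb0 sub0set.
  move=> anb; exists a; first by move: anb; rewrite inE => /andP[].
  by apply/subsetP=> x xnb; rewrite inE; apply/eqP; apply: (card_le1_eqP degb).
(* Take v at an end of an edge of H, or arbitrary if no edge is left. *)
have [v vQ leHv] : exists2 v : 'I_m, v \in Q & #|edges_in H P (Q :\ v)| <= #|Y|.-2.
  have [H0 | [[p v]]] := set_0Vmem (edges_in H P Q).
    have [v vQ] : exists v, v \in Q by apply/card_gt0P; lia.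
    exists v => //; apply: leq_trans (edges_in_sub H (subxx P) (subD1set Q v)) _.
    by rewrite H0 cards0.
  rewrite inE /= => /and3P[pvH pP vQ]; exists v => //.
  have nb_gt0 : 0 < #|nbU H P v| by apply/card_gt0P; exists p; rewrite inE pP.
  have arith a' b' c : 0 < a' -> a' + b' <= c.-1 -> b' <= c.-2 by lia.
  by apply: arith nb_gt0 _; rewrite -edges_in_remove.
apply: (packs_placeU (a := a) uP) => [y w _ wQ _|]; first exact: nbV0P wQ.
(* With a already placed, b has no neighbour left in X and may go to any v. *)
apply: (packs_placeV (b := b) vQ).
  move=> x p; rewrite !inE => /andP[x'a xX] _ xbT.
  by have := subsetP nba x; rewrite !inE xX xbT (negPf x'a) => /(_ isT).
apply: IHk; rewrite ?cardsD1_pred //; try lia.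
exact: leq_trans (edges_in_sub H subP (subxx (Q :\ v))) leHv.
Qed.

(** * Packing when H has at most m edges *)

(** Meant for N the neighbourhood of a vertex b: once N lies on isolated vertices of H, b may go
    anywhere. *)
Lemma packs_place_nbrs n m (T H : bipgraph n m) (X P N I : {set 'I_n})
    (Y Q : {set 'I_m}) :
  N \subset X -> I \subset P -> #|N| = #|I| ->
  {in I, forall u, nbV H Q u = set0} ->
  packs T H (X :\: N) Y (P :\: I) Q -> packs T H X Y P Q.
Proof.
have [k] := ubnP #|N|; elim: k X P N I => // k IHk X P N I le_Nk sNX sIP cNI isoI.
have [N0 | [a aN]] := set_0Vmem N.
  move: cNI; rewrite N0 cards0 => /esym/eqP; rewrite cards_eq0 => /eqP->.
  by rewrite !setD0.
have N_gt0 : 0 < #|N| by apply/card_gt0P; exists a.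
have [u uI] : exists u, u \in I by apply/card_gt0P; rewrite -cNI.
move=> packed; apply: (packs_placeU (a := a) (subsetP sIP u uI)) => [y v _ vQ _|].
  exact: nbV0P (isoI u uI) vQ.
apply: (IHk _ _ (N :\ a) (I :\ u)); rewrite ?setSD ?cardsD1_pred //; try lia.
  by move=> w; rewrite inE => /andP[_ /isoI].
have -> : (X :\ a) :\: (N :\ a) = X :\: N.
  by apply/setP=> x; rewrite !inE; case: eqVneq => [->|] //=; rewrite aN.
have -> // : (P :\ u) :\: (I :\ u) = P :\: I.
by apply/setP=> x; rewrite !inE; case: eqVneq => [->|] //=; rewrite uI.
Qed.

(** Within X and Y, a and b can have only each other as neighbours, so the pair uv is the only
    possible conflict. *)
Lemma packs_placeUV n m (T H : bipgraph n m) (X P : {set 'I_n})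
    (Y Q : {set 'I_m}) (a u : 'I_n) (b v : 'I_m) :
  u \in P -> v \in Q -> (u, v) \notin H ->
  {in X :\ a, forall x, (x, b) \notin T} ->
  {in Y :\ b, forall y, (a, y) \notin T} ->
  packs T H (X :\ a) (Y :\ b) (P :\ u) (Q :\ v) -> packs T H X Y P Q.
Proof.
move=> uP vQ uvH nbb nba [f [g [injf injg fP gQ fg]]].
have fP' x : x \in X -> x != a -> f x \in P :\ u by move=> xX x'a; rewrite fP // !inE x'a.
have gQ' y : y \in Y -> y != b -> g y \in Q :\ v by move=> yY y'b; rewrite gQ // !inE y'b.
exists (fun x => if x == a then u else f x), (fun y => if y == b then v else g y); split.
- move=> x x' xX x'X /=; case: (eqVneq x a) => [-> | xa]; case: (eqVneq x' a) => [-> | x'a] //.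
  + by move=> eq_u; have := fP' x' x'X x'a; rewrite -eq_u !inE eqxx.
  + by move=> eq_u; have := fP' x xX xa; rewrite eq_u !inE eqxx.
  + by apply: injf; rewrite !inE ?xa ?x'a.
- move=> y y' yY y'Y /=; case: (eqVneq y b) => [-> | yb]; case: (eqVneq y' b) => [-> | y'b] //.
  + by move=> eq_v; have := gQ' y' y'Y y'b; rewrite -eq_v !inE eqxx.
  + by move=> eq_v; have := gQ' y yY yb; rewrite eq_v !inE eqxx.
  + by apply: injg; rewrite !inE ?yb ?y'b.
- by move=> x xX /=; case: (eqVneq x a) => // /(fP' x xX); rewrite inE => /andP[].
- by move=> y yY /=; case: (eqVneq y b) => // /(gQ' y yY); rewrite inE => /andP[].
move=> x y xX yY /=; case: (eqVneq x a) => [-> | xa]; case: (eqVneq y b) => [-> | yb] //.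
- by apply: contraTT => _; apply: nba; rewrite !inE yb.
- by apply: contraTT => _; apply: nbb; rewrite !inE xa.
- by apply: fg; rewrite // !inE ?xa ?yb.
Qed.

Lemma edges_inT n m (G : bipgraph n m) : edges_in G setT setT = G.
Proof. by apply/setP=> p; rewrite inE !in_setT !andbT. Qed.

Lemma leq_isolated n m (H : bipgraph n m) :
  n - #|H| <= #|[set u | nbV H setT u == set0]|.
Proof.
set I := [set u | _].
suff leI : #|~: I| <= #|H| by have := cardsC I; rewrite card_ord; lia.
rewrite -(edges_inT H) edges_in_sumV -sum1_card [leqRHS](big_setID (~: I)) setTI.
apply: leq_trans (leq_addr _ _); apply: leq_sum => u.
by rewrite !inE -card_gt0.
Qed.

Lemma exists_subset_card (T : finType) (A : {set T}) k :
  k <= #|A| -> exists2 B : {set T}, B \subset A & #|B| = k.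
Proof.
move=> le_kA; exists [set x in take k (enum A)].
  by apply/subsetP=> x; rewrite inE => /mem_take; rewrite mem_enum.
rewrite cardsE (card_uniqP _) ?take_uniq ?enum_uniq //.
by rewrite size_takel // -cardE.
Qed.

(** With the neighbours of b on isolated vertices and b on v, at most m - 2 edges of H remain for m
    - 1 vertices of V, as the sparse case requires. The last hypothesis keeps the remaining part of
    U at least as large. *)
Lemma packs_min_degree n m (T H : bipgraph n m) (b v : 'I_m) :
  acyclic (adj T) -> #|H| <= m -> 1 < #|nbU H setT v| ->
  #|nbU T setT b| <= #|[set u | nbV H setT u == set0]| ->
  #|nbU T setT b| + m <= n.+1 ->
  packs T H setT setT setT setT.
Proof.
move=> acyc leH degv le_iso le_nm; set N := nbU T setT b in le_iso le_nm.
have [I sIiso cI] := exists_subset_card le_iso.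
apply: (@packs_place_nbrs _ _ _ _ _ _ N I) => //; try exact: subsetT.
  by move=> u /(subsetP sIiso); rewrite inE => /eqP.
apply: (packs_placeV (b := b) (in_setT v)).
  by move=> x u; rewrite !inE /= => /andP[/negPf->].
have := edges_in_remove H setT (in_setT v); rewrite edges_inT => eqH.
apply: packs_sparse => //; rewrite ?cardsD1_pred ?in_setT // ?cardsDS ?subsetT //;
  rewrite ?cI ?cardsT ?card_ord //; first by lia.
apply: leq_trans (edges_in_sub H (subsetT _) (subxx _)) _.
have arith h d r : h = d + r -> h <= m -> 1 < d -> r <= m.-2 by lia.
exact: arith eqH leH degv.
Qed.

Lemma packs_all_degree2 n m (T H : bipgraph n m) (v : 'I_m) :
  acyclic (adj T) -> n = m.+1 -> #|H| <= m -> 1 < #|nbU H setT v| < m ->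
  (forall b, 1 < #|nbU T setT b|) ->
  packs T H setT setT setT setT.
Proof.
move=> acyc eq_nm leH /andP[degv_gt1 degv_ltm] degT.
(* For n = m + 1 the forest bound n + m - 1 is 2m, so all degrees in V equal 2, while the m + 1
   vertices of U cannot all have degree at least 2. *)
have leT : #|T| <= m * 2.
  by have := forest_edges setT setT acyc; rewrite edges_inT !cardsT !card_ord => /leq_trans; apply; lia.
have [a dega] : exists a, #|nbV T setT a| <= 1.
  suff /existsP : [exists a, #|nbV T setT a| <= 1] by [].
  apply: contraLR leT; rewrite negb_exists -ltnNge => /forallP degA.
  rewrite -(edges_inT T) edges_in_sumV.
  apply: (@leq_trans (\sum_(x in [set: 'I_n]) 2)).
    by rewrite sum_nat_const cardsT card_ord; lia.
  by apply: leq_sum => x _; rewrite ltnNge.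
have [b abT] : exists b, (a, b) \in T.
  suff /existsP : [exists b, (a, b) \in T] by [].
  apply: contraT; rewrite negb_exists => /forallP nba.
  (* If a were isolated, the rest of T would have m vertices in each class, and some b would have
     degree at most 1. *)
  have [||b _] := @exists_degree_le1 n m T (setT :\ a) setT acyc.
  - by rewrite cardsT card_ord; lia.
  - by rewrite cardsD1_pred ?in_setT // !cardsT !card_ord; lia.
  rewrite leqNgt; case/negP; apply: leq_trans (degT b) _.
  apply/subset_leq_card/subsetP=> x; rewrite !inE /= => xbT; rewrite xbT !andbT.
  by apply: contraTneq xbT => ->; apply: nba.
have degb : #|nbU T setT b| <= 2.
  have := edges_in_remove T setT (in_setT b); rewrite edges_inT => eqT.
  have : \sum_(y in [set: 'I_m] :\ b) 2 <= #|edges_in T setT (setT :\ b)|.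
    by rewrite edges_in_sumU; apply: leq_sum => y _; apply: degT.
  rewrite sum_nat_const cardsD1_pred ?in_setT // cardsT card_ord => le2.
  have arith t d r : t = d + r -> t <= m * 2 -> m.-1 * 2 <= r -> d <= 2 by lia.
  exact: arith eqT leT le2.
have a_nb : a \in nbU T setT b by rewrite !inE.
have [a1 a1_nb] : exists a1, a1 \in nbU T setT b :\ a.
  by apply/card_gt0P; rewrite cardsD1_pred //; have := degT b; lia.
have nb_sub x : (x, b) \in T -> x != a -> x = a1.
  move=> xbT x'a; have le1 : #|nbU T setT b :\ a| <= 1 by rewrite cardsD1_pred //; lia.
  by apply: (card_le1_eqP le1); rewrite // !inE x'a.
have [u0 _ isou0] : exists2 u0, u0 \in [set: 'I_n] & nbV H setT u0 = set0.
  by apply: exists_isolated; rewrite edges_inT cardsT card_ord; lia.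
(* Since v has at most m - 1 = n - 2 neighbours in H, it has a non-neighbour besides [u0]. *)
have [u1] : exists u1, u1 \in ~: nbU H setT v :\ u0.
  apply/card_gt0P; rewrite cardsD1_pred; last by rewrite !inE /= (nbV0P isou0) ?in_setT.
  by have := cardsC (nbU H setT v); rewrite card_ord; lia.
rewrite !inE /= => /andP[u1'0 u1vH].
apply: (packs_placeU (a := a1) (in_setT u0)) => [y w _ wQ _|]; first exact: nbV0P wQ.
apply: (packs_placeUV (a := a) (b := b) (u := u1) (v := v)); rewrite ?inE ?u1'0 //.
- move=> x; rewrite !inE andbT => /andP[x'a x'a1]; apply: contra x'a1 => xbT.
  by rewrite (nb_sub x).
- move=> y; rewrite !inE andbT => y'b; apply: contra y'b => ayT.
  by apply/eqP; apply: (card_le1_eqP dega); rewrite !inE.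
have := edges_in_remove H setT (in_setT v); rewrite edges_inT => eqH.
have a'a1 : a \in [set: 'I_n] :\ a1.
  by move: a1_nb; rewrite !inE eq_sym => /andP[->].
have u1u0 : u1 \in [set: 'I_n] :\ u0 by rewrite !inE u1'0.
apply: packs_sparse => //; rewrite !cardsD1_pred ?in_setT ?cardsT ?card_ord //; first by lia.
apply: leq_trans (edges_in_sub H (subsetT _) (subxx _)) _.
have arith h d r : h = d + r -> h <= m -> 1 < d -> r <= m.-2 by lia.
exact: arith eqH leH degv_gt1.
Qed.

Lemma packs_extremal n m (T H : bipgraph n m) (u : 'I_n) (v : 'I_m) :
  acyclic (adj T) -> m <= n -> #|H| <= m -> nbV H setT u = set0 ->
  1 < #|nbU H setT v| -> (n = m.+1 -> #|nbU H setT v| < m) ->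
  packs T H setT setT setT setT.
Proof.
move=> acyc le_mn leH isou degv degv_lt.
have [b _ b_min] := @arg_minnP _ v xpredT (fun y => #|nbU T setT y|) isT.
have leT : m * #|nbU T setT b| <= (n + m).-1.
  have := forest_edges setT setT acyc; rewrite !cardsT !card_ord; apply: leq_trans.
  rewrite edges_in_sumU -{1}(card_ord m) -cardsT -sum_nat_const.
  by apply: leq_sum => y _; apply: b_min.
have m_gt1 : 1 < m.
  apply: leq_trans degv (leq_trans _ leH).
  by rewrite -{2}(edges_inT H) (edges_in_remove H setT (in_setT v)) leq_addr.
have iso_gt0 : 0 < #|[set u | nbV H setT u == set0]|.
  by apply/card_gt0P; exists u; rewrite inE isou.
have iso_ge : n - m <= #|[set u | nbV H setT u == set0]|.
  by apply: leq_trans (leq_isolated H); apply: leq_sub2l.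
have [le_b1 | lt_1b] := leqP #|nbU T setT b| 1.
  by apply: (packs_min_degree (b := b) acyc leH degv); [exact: leq_trans iso_gt0 | lia].
have [eq_nm | ne_nm] := eqVneq n m.+1.
  apply: (packs_all_degree2 acyc eq_nm leH (v := v)); first by rewrite degv degv_lt.
  by move=> y; apply: leq_trans (b_min y isT).
(* Let d be the degree of b and k = n - m. Then m(d - 2) <= k - 1 with d >= 2 gives k >= 1, hence k
   >= 2 as n differs from m + 1; now m >= 2 yields d <= k. *)
have le_b : #|nbU T setT b| <= n - m by move: ne_nm; nia.
by apply: (packs_min_degree (b := b) acyc leH degv); [exact: leq_trans le_b _ | lia].
Qed.

(** * From packings to subgraphs, and degrees in the bipartite complement *)

Lemma packs_contains n m (T G : bipgraph n m) :
  packs T (~: G) setT setT setT setT -> contains G T.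
Proof.
case=> f [g [injf injg _ _ fg]].
exists (fun x => match x with inl u => inl (f u) | inr v => inr (g v) end); split.
  by case=> [u|v] [u'|v'] //= []; [move/injf-> | move/injg->].
have fgG u v : (u, v) \in T -> (f u, g v) \in G.
  by move=> uvT; have := fg u v (in_setT _) (in_setT _) uvT; rewrite inE negbK.
by case=> [u|v] [u'|v'] //=; apply: fgG.
Qed.

Lemma degree_inr n m (G : bipgraph n m) v :
  degree G (inr v) + #|nbU (~: G) setT v| = n.
Proof.
have -> : degree G (inr v) = #|[set u | (u, v) \in G]|.
  rewrite /degree -(card_imset _ (@inl_inj 'I_n 'I_m)).
  apply: eq_card => -[u|w]; rewrite !inE /=; first by rewrite mem_imset ?inE //; apply: inl_inj.
  by apply/esym/imsetP=> -[].
rewrite -[RHS]card_ord -(cardsC [set u | (u, v) \in G]); congr (_ + _).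
by apply: eq_card => u; rewrite !inE.
Qed.

Lemma degree_inl n m (G : bipgraph n m) u :
  degree G (inl u) + #|nbV (~: G) setT u| = m.
Proof.
have -> : degree G (inl u) = #|[set v | (u, v) \in G]|.
  rewrite /degree -(card_imset _ (@inr_inj 'I_n 'I_m)).
  apply: eq_card => -[w|v]; rewrite !inE /=; last by rewrite mem_imset ?inE //; apply: inr_inj.
  by apply/esym/imsetP=> -[].
rewrite -[RHS]card_ord -(cardsC [set v | (u, v) \in G]); congr (_ + _).
by apply: eq_card => v; rewrite !inE.
Qed.

Lemma card_compl_sumU n m (G : bipgraph n m) :
  #|~: G| = \sum_v #|nbU (~: G) setT v|.
Proof. by rewrite -{1}(edges_inT (~: G)) edges_in_sumU; apply: eq_bigl => v; rewrite inE. Qed.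

Lemma card_compl_sumV n m (G : bipgraph n m) :
  #|~: G| = \sum_u #|nbV (~: G) setT u|.
Proof. by rewrite -{1}(edges_inT (~: G)) edges_in_sumV; apply: eq_bigl => v; rewrite inE. Qed.

Lemma card_compl n m (G : bipgraph n m) : #|edges G| + #|~: G| = n * m.
Proof. by rewrite cardsC card_prod !card_ord. Qed.

Lemma contains_degree n m (G T : bipgraph n m) f x :
  injective f -> (forall x y, adj T x y -> adj G (f x) (f y)) ->
  degree T x <= degree G (f x).
Proof.
move=> injf fG; rewrite /degree -(card_imset _ injf).
apply/subset_leq_card/subsetP=> _ /imsetP[y xy ->].
by move: xy; rewrite !inE; apply: fG.
Qed.

(** * Trees missing from the extremal graphs: double star and spider *)

Section LowerBound.

Variables n m : nat.
Hypotheses (m_gt0 : 0 < m) (le_mn : m <= n).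

Let u0 : 'I_n := Ordinal (leq_trans m_gt0 le_mn).
Let v0 : 'I_m := Ordinal m_gt0.

Definition double_star : bipgraph n m :=
  [set p : 'I_n * 'I_m | (p.1 == 0 :> nat) || (p.2 == 0 :> nat)].

Lemma double_star_tree : is_tree double_star.
Proof.
apply: (@rooted_tree _ _ (inl u0)
  (fun x => match x with inl _ => inr v0 | inr _ => inl u0 end)
  (fun x => match x with
            | inl u => if u == 0 :> nat then 0 else 2
            | inr v => if v == 0 :> nat then 1 else 2
            end)); first exact: adj_sym.
- move=> [u|v] /=; last by rewrite inE /=; case: eqP.
  rewrite (inj_eq inl_inj) -(inj_eq val_inj) /= => u'0.
  by rewrite inE /= orbT (negPf u'0).
move=> [u|v] [u'|v'] //=; rewrite inE /=.
  case: (u == 0 :> nat) => /=; first by case: (v' == 0 :> nat).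
  by move=> v'0 _; congr inr; apply/val_inj/eqP.
case: (eqVneq (u' : nat) 0) => [u'0 _ _|/= _ /eqP->//].
by congr inl; apply: val_inj.
Qed.

Lemma degree_double_star :
  degree double_star (inr v0) = n /\ degree double_star (inl u0) = m.
Proof.
split.
  have := degree_inr double_star v0.
  have -> : nbU (~: double_star) setT v0 = set0 by apply/setP=> u; rewrite !inE /= orbT.
  by rewrite cards0 addn0.
have := degree_inl double_star u0.
have -> : nbV (~: double_star) setT u0 = set0 by apply/setP=> u; rewrite !inE.
by rewrite cards0 addn0.
Qed.

(** The adjacent centres have degrees n and m, and so at least these in G. If the classes are
    swapped, a vertex of U has degree at least n, which forces n = m. *)
Lemma double_star_not_contained (G : bipgraph n m) :
  (forall v : 'I_m, degree G (inr v) = n - 1) \/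
  n = m /\ (forall u : 'I_n, degree G (inl u) = n - 1) ->
  ~ contains_all_trees n m G.
Proof.
move=> degG /(_ _ double_star_tree)[f [injf fG]].
have [dv du] := degree_double_star.
have leV := contains_degree (inr v0) injf fG; rewrite dv in leV.
have leU := contains_degree (inl u0) injf fG; rewrite du in leU.
have : adj G (f (inl u0)) (f (inr v0)) by apply: fG; rewrite /= inE.
move: leU leV; case: (f (inl u0)) (f (inr v0)) => [u|v] [u'|v'] //= leU leV _.
  by case: degG => [degG | [eq_nm degG]]; [move: leV | move: leU]; rewrite degG; lia.
by case: degG => [degG | [eq_nm degG]]; [move: leU | move: leV]; rewrite degG;
  have := degree_inl G u'; lia.
Qed.

(** The centre is 0 in U, and the leg through v ends at v + 1; for n = m + 1 the legs cover all
    other vertices. *)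
Definition spider : bipgraph n m :=
  [set p : 'I_n * 'I_m | (p.1 == 0 :> nat) || (p.1 == p.2.+1 :> nat)].

Hypothesis eq_nm : n = m + 1.

Lemma spider_tree : is_tree spider.
Proof.
apply: (@rooted_tree _ _ (inl u0)
  (* For n = m + 1 the value [u.-1] is always below m, so the default [v0] is never reached. *)
  (fun x => match x with inl u => inr (insubd v0 u.-1) | inr _ => inl u0 end)
  (fun x => match x with
            | inl u => if u == 0 :> nat then 0 else 2
            | inr v => 1
            end)); first exact: adj_sym.
- move=> [u|v] /=; last by rewrite inE.
  rewrite (inj_eq inl_inj) -(inj_eq val_inj) /= => u'0.
  rewrite inE /= (negPf u'0) /= val_insubd; split=> //.
  by have := ltn_ord u; case: ifP; lia.
move=> [u|v] [u'|v'] //=; rewrite inE /=.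
  case: (u == 0 :> nat) => //= /eqP u_eq _; congr inr; apply: val_inj.
  by rewrite val_insubd u_eq /= ltn_ord.
by case: (eqVneq (u' : nat) 0) => //= u'0 _ _; congr inl; apply: val_inj.
Qed.

Lemma degree_spider v : 2 <= degree spider (inr v).
Proof.
have lt_vn : v.+1 < n by have := ltn_ord v; lia.
have -> : 2 = #|[set inl u0; inl (Ordinal lt_vn)] : {set 'I_n + 'I_m}|.
  by rewrite cards2 (inj_eq inl_inj).
apply/subset_leq_card/subsetP=> y; rewrite !inE => /orP[] /eqP-> /=; rewrite inE //=.
Qed.

Definition inU (x : 'I_n + 'I_m) := if x is inl _ then true else false.

Lemma adj_inU (G : bipgraph n m) x y : adj G x y -> inU x = ~~ inU y.
Proof. by case: x y => [u|v] [u'|v']. Qed.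

(** An embedding is a bijection of the vertices that either preserves or swaps the classes. The
    preimage of [v1] has degree at most 1, so it lies in U; the classes are then swapped, and n
    vertices would inject into m < n. *)
Lemma spider_not_contained (G : bipgraph n m) v1 :
  degree G (inr v1) <= 1 -> ~ contains_all_trees n m G.
Proof.
move=> degv1 /(_ _ spider_tree)[f [injf fG]].
have [g fK gK] := injF_bij injf.
(* Whether f changes the class of a vertex is constant along edges, hence on the whole connected
   spider. *)
have flip x : inU x (+) inU (f x) = inU (g (inr v1)).
  have conn : connect (adj spider) (g (inr v1)) x by apply: spider_tree.1.2.
  pose A := [pred z | inU z (+) inU (f z)].
  have clA : closed (adj spider) A.
    move=> y z yz; rewrite !inE (adj_inU yz) (adj_inU (fG _ _ yz)).
    by case: (inU z); case: (inU (f z)).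
  by have := closed_connect clA conn; rewrite !inE gK addbF => ->.
have gU : inU (g (inr v1)).
  case def_g: (g (inr v1)) => [//|v].
  have := contains_degree (inr v) injf fG; rewrite -{2}def_g gK => le_v.
  by have := leq_trans (degree_spider v) (leq_trans le_v degv1).
pose h (u : 'I_n) : 'I_m := if f (inl u) is inr v then v else v1.
have injh : injective h.
  move=> u u'; rewrite /h.
  have := flip (inl u); have := flip (inl u'); rewrite gU.
  case: (f (inl u)) (f (inl u')) (injf (inl u) (inl u')) => [?|v] [?|v'] //= inj _ _ eq_v.
  by have [] := inj (congr1 inr eq_v).
by have := leq_card h injh; rewrite !card_ord; lia.
Qed.

End LowerBound.

(** * The extremal number and the extremal graphs *)

Lemma not_containing_edges n m (G : bipgraph n m) :
  0 < m -> m <= n -> ~ contains_all_trees n m G -> m <= #|~: G|.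
Proof.
move=> m_gt0 le_mn notG; rewrite leqNgt; apply/negP => ltG; apply: notG => T [_ acyc].
apply: packs_contains; apply: packs_sparse => //; first by rewrite !cardsT !card_ord.
by rewrite edges_inT cardsT card_ord; lia.
Qed.

Lemma ex_value n m : 0 < m -> m <= n -> ex n m n m = (n - 1) * m.
Proof.
move=> m_gt0 le_mn; apply/eqP; rewrite eqn_leq; apply/andP; split.
  apply/bigmax_leqP=> G /asboolP /(not_containing_edges m_gt0 le_mn).
  by have := card_compl G; rewrite mulnBl; lia.
pose u0 : 'I_n := Ordinal (leq_trans m_gt0 le_mn).
(* All edges except those at [u0]: each vertex of V misses exactly one neighbour. *)
pose G : bipgraph n m := [set p | p.1 != u0].
have nbG v : #|nbU (~: G) setT v| = 1.
  by rewrite -(cards1 u0); apply: eq_card => u; rewrite !inE negbK.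
have degG v : degree G (inr v) = n - 1.
  by have := degree_inr G v; rewrite nbG; lia.
have notG : ~ contains_all_trees n m G.
  by apply: (double_star_not_contained m_gt0 le_mn); left.
apply: leq_trans (leq_bigmax_cond _ (_ : `[< ~ contains_all_trees n m G >])); last exact/asboolP.
have := card_compl G; rewrite card_compl_sumU (eq_bigr _ (fun v _ => nbG v)).
by rewrite sum1_card card_ord mulnBl; lia.
Qed.

Lemma extremalP n m (G : bipgraph n m) : 0 < m -> m <= n ->
  extremal n m G <-> #|~: G| = m /\ ~ contains_all_trees n m G.
Proof.
move=> m_gt0 le_mn; rewrite /extremal ex_value // mulnBl.
have := card_compl G; have : m <= n * m by rewrite leq_pmull; lia.
by move=> ? ?; split=> -[? ?]; split=> //; lia.
Qed.

Lemma leq1_sum_eq (I : finType) (d : I -> nat) :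
  (forall i, d i <= 1) -> \sum_i d i = #|I| -> forall i, d i = 1.
Proof.
move=> d_le1 sum_d i; apply/eqP; move: i; apply/forallP.
have /leqif_sum leS : forall i, true -> d i <= 1 ?= iff (d i == 1) by move=> i _; split.
by rewrite -leS.2 sum_d sum1_card.
Qed.

Lemma sum_concentrated (I : finType) (d : I -> nat) i k :
  \sum_j d j = k -> k <= d i -> d i = k /\ forall j, j != i -> d j = 0.
Proof.
move=> sum_d le_ki; rewrite (bigD1 i) //= in sum_d; split; first by lia.
by move=> j j'i; rewrite (bigD1 j) //= in sum_d; lia.
Qed.

(** The complement has exactly m edges. Unless all its degrees in V are 1, some v has degree at
    least 2; then either no vertex of U is isolated, or the packing for m edges leaves only the star
    at v with n = m + 1. *)
Lemma extremal_degree_compl n m (G : bipgraph n m) : 0 < m -> m <= n ->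
  extremal n m G ->
  [\/ forall v, #|nbU (~: G) setT v| = 1,
      n = m /\ forall u, #|nbV (~: G) setT u| = 1
    | n = m.+1 /\ exists2 v, #|nbU (~: G) setT v| = m
                   & forall v', v' <> v -> #|nbU (~: G) setT v'| = 0].
Proof.
move=> m_gt0 le_mn /(extremalP _ m_gt0 le_mn) [eH notG].
have [/forallP le1 | ] := boolP [forall v, #|nbU (~: G) setT v| <= 1].
  by apply: Or31; apply: leq1_sum_eq => //; rewrite -card_compl_sumU eH card_ord.
rewrite negb_forall => /existsP[v]; rewrite -ltnNge => degv.
have [/existsP[u /eqP isou] | ] := boolP [exists u, nbV (~: G) setT u == set0]; last first.
  rewrite negb_exists => /forallP noiso; apply: Or32.
  (* All n >= m vertices of U meet one of the m edges, so n = m and each meets exactly one. *)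
  have le_sum : \sum_(u < n) 1 <= #|~: G|.
    by rewrite card_compl_sumV; apply: leq_sum => u _; rewrite card_gt0.
  have eq_nm : n = m by move: le_sum; rewrite sum1_card card_ord eH; lia.
  split=> // u; apply/eqP; move: u; apply/forallP.
  have /leqif_sum leS : forall u, true -> 1 <= #|nbV (~: G) setT u| ?= iff (1 == #|nbV (~: G) setT u|).
    by move=> u _; split; rewrite ?card_gt0.
  under eq_forallb => u do rewrite eq_sym.
  by rewrite -leS.2 -card_compl_sumV sum1_card card_ord eH eq_nm.
case: (pselect (n = m.+1 /\ m <= #|nbU (~: G) setT v|)) => [[eq_nm degv_ge] | not_star].
  have [degv_eq deg0] := sum_concentrated (esym (etrans (esym eH) (card_compl_sumU G))) degv_ge.
  by apply: Or33; split=> //; exists v => // v' /eqP /deg0.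
case: notG => T [_ acyc]; apply: packs_contains.
apply: (packs_extremal acyc le_mn _ isou degv); first by rewrite eH.
by move=> eq_nm; rewrite ltnNge; apply/negP=> ?; apply: not_star.
Qed.

Theorem theorem1p6 (n m : nat) (hm : 1 <= m) (hmn : m <= n) :
  ex n m n m = (n - 1) * m
  /\ (n = m -> forall G : bipgraph n m,
        extremal n m G <->
        ((forall u : 'I_n, degree G (inl u) = n - 1)
         \/ (forall v : 'I_m, degree G (inr v) = n - 1)))
  /\ (n = m + 1 -> forall G : bipgraph n m,
        extremal n m G <->
        ((forall v : 'I_m, degree G (inr v) = n - 1)
         \/ (exists v1 : 'I_m, degree G (inr v1) = 1
              /\ forall v : 'I_m, v <> v1 -> degree G (inr v) = n)))
  /\ (n > m + 1 -> forall G : bipgraph n m,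
        extremal n m G <->
        (forall v : 'I_m, degree G (inr v) = n - 1)).
Proof.
(* This pattern is extremal for every n >= m and serves all three cases. *)
have regV (G : bipgraph n m) :
    (forall v : 'I_m, degree G (inr v) = n - 1) -> extremal n m G.
  move=> degG; apply/(extremalP _ hm hmn); split; last by apply: (double_star_not_contained hm hmn); left.
  rewrite card_compl_sumU -[RHS]card_ord -sum1_card; apply: eq_bigr => v _.
  by have := degree_inr G v; rewrite degG; lia.
have regV' (G : bipgraph n m) v :
    #|nbU (~: G) setT v| = 1 -> degree G (inr v) = n - 1.
  by have := degree_inr G v; lia.
split; first exact: ex_value.
split=> [eq_nm G|]; [split|split=> [eq_nm G|lt_mn G]; split].
- case/(extremal_degree_compl hm hmn)=> [degH | [_ degH] | [eq_nm' _]]; last by lia.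
    by right=> v; apply: regV'.
  by left=> u; have := degree_inl G u; rewrite degH; lia.
- case=> [degG | /regV //]; apply/(extremalP _ hm hmn); split.
    rewrite card_compl_sumV; apply: etrans (etrans (sum1_card 'I_n) _); last by rewrite card_ord.
    apply: eq_bigr => u _.
    by have := degree_inl G u; rewrite degG; lia.
  by apply: (double_star_not_contained hm hmn); right.
- case/(extremal_degree_compl hm hmn)=> [degH | [eq_nm' _] | [_ [v degv degv']]].
  + by left=> v; apply: regV'.
  + by lia.
  + right; exists v; split; first by have := degree_inr G v; rewrite degv; lia.
    by move=> v' /degv' deg0; have := degree_inr G v'; rewrite deg0; lia.
- case=> [/regV // | [v1 [degv1 degG]]]; apply/(extremalP _ hm hmn); split.
    have nbv1 : #|nbU (~: G) setT v1| = m by have := degree_inr G v1; rewrite degv1; lia.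
    rewrite card_compl_sumU (bigD1 v1) //= nbv1 big1 ?addn0 // => v /eqP /degG dv.
    by apply/(@addnI n); rewrite addn0 -{1}dv degree_inr.
  by apply: (spider_not_contained hm hmn eq_nm (v1 := v1)); rewrite degv1.
- case/(extremal_degree_compl hm hmn)=> [degH v | [eq_nm' _] | [eq_nm' _]];
    by [exact: regV' | lia].
- exact: regV.
Qed.
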